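(* For $\alpha\in\mathbb{R}$ and $N\in\mathbb{N}$ let $$D_N=\sup_{0\le a<b\le1}\left|\frac1N\sum_{n=1}^N\chi_{[a,b]}\left(\left\{\frac{(n-\alpha)^2}{2N}\right\}\right)-(b-a)\right|.$$ Then $$D_N=O\left(\frac{\log N\left(\sqrt{\log N}+\tau(N)\right)}{\sqrt N}\right)$$ as $N\to\infty$, where the implied constant is independent of $\alpha$.
   Context: $\{x\}$ denotes the fractional part of $x$, $\chi_{[a,b]}$ is the characteristic function of $[a,b]$, and $\tau(n)=\sum_{d\mid n}1$ is the divisor function. *)

(* Defs.v *)
From mathcomp Require Import all_boot all_order all_algebra.
From mathcomp Require Import all_classical all_reals all_analysis.

Set Implicit Arguments.
Unset Strict Implicit.
Unset Printing Implicit Defensive.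

Import Order.TTheory GRing.Theory Num.Theory.
Import numFieldNormedType.Exports.

Local Open Scope classical_set_scope.
Local Open Scope ring_scope.

Definition fractional_part {R : realType} (x : R) : R := x - (Num.floor x)%:~R.

(* [divisors 0 = [:: 1]], so [tau] is the divisor function on [n > 0] only. *)
Definition tau (n : nat) : nat := (\sum_(d <- divisors n) 1)%N.

Definition local_discrepancy {R : realType} (N : nat) (alpha a b : R) : R :=
  `| N%:R^-1 * (\sum_(1 <= n < N.+1)
       \1_(`[a, b]) (fractional_part ((n%:R - alpha) ^+ 2 / (2 * N%:R))))
     - (b - a) |.

(* For [N > 0] the set is nonempty and bounded above (by 1), so the real-valued
   [sup] is a genuine supremum. *)
Definition discrepancy {R : realType} (N : nat) (alpha : R) : R :=
  sup [set x : R | exists a b : R,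
         [/\ 0 <= a, a < b, b <= 1 & x = local_discrepancy N alpha a b]].

(* Main.v *)
Require Import Defs.
From mathcomp Require Import all_boot all_order all_algebra.
From mathcomp Require Import all_classical all_reals all_analysis.
From mathcomp Require Import ring lra.

Import Order.TTheory GRing.Theory Num.Theory.
Import numFieldNormedType.Exports.

Local Open Scope classical_set_scope.
Local Open Scope ring_scope.

(** Weyl differencing bounds the exponential sum [S_k] of the points
    [(n - alpha)^2 / (2 N)]: the inner sums of [|S_k|^2] are geometric with
    ratio [e(k h / N)], so [|S_k|^2] is at most a constant times
    [N (gcd(k, N) + ln N)], uniformly in [alpha].  The gcd is what produces
    [tau N], since the sum of [gcd(k, N) / k] over [k <= K] is at most
    [tau N] times the [K]-th harmonic number.

    The bounds on [S_k] pass to the discrepancy through a crude form of the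
    Erdos-Turan inequality: the indicator of an interval, enlarged by [delta],
    is averaged against the Fejer kernel of order [K] over a grid of [2 K]
    points.  The averaged kernel is a trigonometric polynomial which exceeds
    the indicator up to [4 / (K delta^2)], because away from [0] the kernel is
    at most [4 / (K delta^2)].  Since only [ln K] enters the final bound,
    [K = N^3] and [delta = 1 / N] make every loss [O(1 / N)].  Lower bounds for
    the counting function follow from upper bounds on complementary intervals. *)

(** * Trigonometric sums along arithmetic progressions *)

Lemma cosD_nat2pi {R : realType} (x : R) (n : nat) :
  cos (x + n%:R * (2 * pi)) = cos x.
Proof.
rewrite [2 * pi]mulrC mulrA mulr_natl mulr_natr -mulrnA mulnC mulrnA.
by elim: n => [|n IH]; rewrite ?mulr0n ?addr0// mulrSr addrA cosD2pi.
Qed.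

Lemma cosB_int2pi {R : realType} (x : R) (m : int) :
  cos (x - m%:~R * (2 * pi)) = cos x.
Proof.
case: m => n.
  by rewrite -{2}(subrK (n%:R * (2 * pi)) x) cosD_nat2pi.
by rewrite NegzE mulrNz mulNr opprK cosD_nat2pi.
Qed.

Lemma sinD_nat2pi {R : realType} (x : R) (n : nat) :
  sin (x + n%:R * (2 * pi)) = sin x.
Proof. by rewrite -!cosBpihalf addrAC cosD_nat2pi. Qed.

(** Since [2 sin eta cos y = sin (y + eta) - sin (y - eta)], the sum telescopes. Keeping the factor
    on the left avoids a case [sin eta = 0]. *)
Lemma sum_cos_telescope {R : realType} (phi eta : R) (n : nat) :
  2 * sin eta * (\sum_(i < n) cos (phi + i%:R * (2 * eta))) =
  sin (phi + n%:R * (2 * eta) - eta) - sin (phi - eta).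
Proof.
elim: n => [|n IH]; first by rewrite big_ord0 mulr0 mul0r addr0 subrr.
rewrite big_ord_recr mulrDr IH /=.
set y := phi + n%:R * (2 * eta).
have -> : phi + n.+1%:R * (2 * eta) - eta = y + eta by rewrite /y -natr1; ring.
rewrite !sinD !sinN !cosN.
by ring.
Qed.

Lemma sum_sin_telescope {R : realType} (phi eta : R) (n : nat) :
  2 * sin eta * (\sum_(i < n) sin (phi + i%:R * (2 * eta))) =
  cos (phi - eta) - cos (phi + n%:R * (2 * eta) - eta).
Proof.
under eq_bigr do rewrite -cosBpihalf addrAC.
rewrite sum_cos_telescope -[phi - pi / 2 + _ - eta]addrA ![phi - pi / 2 + _]addrAC.
by rewrite addrA !sinBpihalf opprK [LHS]addrC.
Qed.

(** The squared modulus of the sum of [e^(i theta)], written with real numbers only. *)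
Definition sqnorm_expsum {R : realType} (n : nat) (theta : nat -> R) : R :=
  (\sum_(i < n) cos (theta i)) ^+ 2 + (\sum_(i < n) sin (theta i)) ^+ 2.

Lemma sqnorm_expsum_ge0 {R : realType} n (theta : nat -> R) :
  0 <= sqnorm_expsum n theta.
Proof. by rewrite addr_ge0 ?sqr_ge0. Qed.

(** After telescoping, four times the left side is the squared distance of two points of the unit
    circle, at most 4. *)
Lemma sqnorm_expsum_arith {R : realType} (phi eta : R) (n : nat) :
  sin eta ^+ 2 * sqnorm_expsum n (fun i => phi + i%:R * (2 * eta)) <= 1.
Proof.
rewrite -(ler_pM2l (_ : 0 < 4)) // mulr1.
have -> : 4 * (sin eta ^+ 2 * sqnorm_expsum n (fun i => phi + i%:R * (2 * eta)))
  = (2 * sin eta * (\sum_(i < n) cos (phi + i%:R * (2 * eta)))) ^+ 2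
  + (2 * sin eta * (\sum_(i < n) sin (phi + i%:R * (2 * eta)))) ^+ 2.
  by rewrite /sqnorm_expsum; ring.
rewrite sum_cos_telescope sum_sin_telescope.
set x := _ + _ - eta; set y := phi - eta.
have := cos_geN1 (x - y); rewrite cosB.
have := cos2Dsin2 x; have := cos2Dsin2 y.
by nra.
Qed.

Lemma sum_cos_arith_le {R : realType} (phi eta : R) (n : nat) :
  `|sin eta| * (\sum_(i < n) cos (phi + i%:R * (2 * eta))) <= 1.
Proof.
have H := sqnorm_expsum_arith phi eta n.
apply: le_trans (ler_norm _) _; rewrite normrM normr_id -normrM.
rewrite -(ler_pXn2r (_ : (0 < 2)%N)) ?nnegrE// expr1n.
rewrite real_normK ?num_real// exprMn.
apply: le_trans H; rewrite ler_wpM2l ?sqr_ge0// /sqnorm_expsum.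
by rewrite lerDl sqr_ge0.
Qed.

(** The two ends of the telescoped sum differ by [h] full turns, and [sin (pi h / M)] is nonzero for
    [0 < h < M]. *)
Lemma sum_cos_full_period {R : realType} (phi : R) (M h : nat) :
  (0 < h < M)%N ->
  \sum_(i < M) cos (phi + i%:R * (2 * (pi * h%:R / M%:R))) = 0.
Proof.
move=> /andP[h0 hM].
have Mn0 : (0 < M)%N by exact: leq_ltn_trans hM.
have M0 : (0 : R) < M%:R by rewrite ltr0n.
have s0 : 0 < sin (pi * h%:R / M%:R) :> R.
  apply: sin_gt0_pi; rewrite divr_gt0 ?mulr_gt0 ?pi_gt0 ?ltr0n//=.
  by rewrite ltr_pdivrMr// ltr_pM2l ?pi_gt0// ltr_nat.
have s1 : 2 * sin (pi * h%:R / M%:R) != 0 :> R by rewrite mulf_neq0// gt_eqF.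
apply: (mulfI s1); rewrite sum_cos_telescope mulr0 (_ : M%:R * _ = h%:R * (2 * pi)); last first.
  by field; rewrite gt_eqF.
by rewrite addrAC sinD_nat2pi subrr.
Qed.

(** * Weyl differencing *)

Lemma sum_sym_by_difference {R : ringType} (f : nat -> nat -> R) (n : nat) :
  (forall i j, f i j = f j i) ->
  \sum_(i < n) \sum_(j < n) f i j =
  \sum_(i < n) f i i + (\sum_(h < n.-1) \sum_(m < n - h.+1) f (m + h.+1)%N m) *+ 2.
Proof.
move=> fC; elim: n => [|n IH]; first by rewrite !big_ord0 mul0rn addr0.
rewrite big_ord_recr /=.
under eq_bigr do rewrite big_ord_recr /=.
rewrite big_split /= IH big_ord_recr [in RHS]big_ord_recr /=.
have -> : \sum_(i < n) f i n = \sum_(i < n) f n i by apply: eq_bigr => i _.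
(* The new index [n] adds to each difference [h + 1] exactly one pair, [(n, n - (h + 1))]. *)
have -> : \sum_(h < n) \sum_(m < n.+1 - h.+1) f (m + h.+1)%N m =
   \sum_(h < n.-1) \sum_(m < n - h.+1) f (m + h.+1)%N m + \sum_(i < n) f n i.
  have -> : \sum_(h < n) \sum_(m < n.+1 - h.+1) f (m + h.+1)%N m =
     \sum_(h < n) (\sum_(m < n - h.+1) f (m + h.+1)%N m + f n (n - h.+1)%N).
    apply: eq_bigr => h _; rewrite subSn// big_ord_recr /=; congr (_ + f _ _).
    by rewrite subnK.
  rewrite big_split /=; congr (_ + _); last first.
    by rewrite [RHS](reindex_inj rev_ord_inj).
  case: n {IH} => [|n]; first by rewrite !big_ord0.
  by rewrite big_ord_recr /= subnn big_ord0 addr0.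
rewrite mulrnDl [X in _ = _ + (_ + X)]mulr2n -!addrA; congr (_ + _).
by rewrite [RHS]addrC -!addrA.
Qed.

(** For a quadratic phase [theta], the difference [theta (m + h + 1) - theta m] is affine in [m], so
    the inner sums become geometric. *)
Lemma sqnorm_expsum_by_difference {R : realType} n (theta : nat -> R) :
  sqnorm_expsum n theta = n%:R +
    2 * \sum_(h < n.-1) \sum_(m < n - h.+1) cos (theta (m + h.+1)%N - theta m).
Proof.
rewrite /sqnorm_expsum !expr2 !big_distrl -big_split /=.
under eq_bigr do rewrite !big_distrr -big_split /=.
under eq_bigr do under eq_bigr do rewrite -cosB.
rewrite (@sum_sym_by_difference _ (fun i j => cos (theta i - theta j))); last first.
  by move=> i j; rewrite -cosN opprB.
rewrite [X in X + _](eq_bigr (fun=> 1)) => [|i _]; last by rewrite subrr cos0.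
by rewrite sumr_const card_ord mulr_natl.
Qed.

(* For [0 <= x <= pi / 2] the mean value theorem gives
   [sin (x / 2) >= (x / 2) cos (x / 2)], and doubling the angle yields
   [sin x >= x cos (x / 2) ^ 2 = x (1 + cos x) / 2 >= x / 2]. *)
Lemma sin_pi_ge {R : realType} (t : R) : 0 <= t <= 1 -> t * (1 - t) <= sin (pi * t).
Proof.
have half (x : R) : 0 <= x <= pi / 2 -> x / 2 <= sin x.
  move=> /andP[x0 xpi].
  have [->|xn0] := eqVneq x 0; first by rewrite mul0r sin0.
  have xp : 0 < x by rewrite lt_def xn0.
  have [c] := @MVT R sin cos 0 (x / 2) (divr_gt0 xp (ltr0Sn _ _))
     (fun y _ => is_derive_sin y) (continuous_subspaceT (@continuous_sin R)).
  rewrite in_itv /= => /andP[c0 cx]; rewrite sin0 !subr0 => sE.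
  have cc : cos (x / 2) <= cos c.
    rewrite ltW// ltr_cos// in_itv /=; have := @pi_gt0 R; lra.
  have hx : 0 <= cos x by apply: cos_ge0_pihalf; have := @pi_gt0 R; lra.
  have hx2 : 0 <= cos (x / 2) by apply: cos_ge0_pihalf; have := @pi_gt0 R; lra.
  have xE : x = (x / 2) *+ 2 by rewrite mulr2n; field.
  have c2 : cos x = cos (x / 2) ^+ 2 *+ 2 - 1 by rewrite {1}xE cos_mulr2n.
  have s2 : sin x = (cos (x / 2) * sin (x / 2)) *+ 2 by rewrite {1}xE sin_mulr2n.
  rewrite s2 sE.
  have : cos (x / 2) * (cos (x / 2) * x) <= cos (x / 2) * (cos c * x).
    by rewrite ler_wpM2l// ler_wpM2r.
  nra.
(* With [pi >= 2], [half] yields [sin (pi t) >= pi t / 2 >= t] on [[0, 1/2]]; the other half follows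
   by the symmetry [t -> 1 - t]. *)
have pi2 := @pi_ge2 R.
move=> /andP[t0 t1]; have [th|th] := leP t (1 / 2).
  apply: le_trans (half (pi * t) _); first by nra.
  by apply/andP; split; nra.
have -> : sin (pi * t) = sin (pi * (1 - t)).
  by rewrite mulrBr mulr1 sinB sinpi cospi; ring.
apply: le_trans (half (pi * (1 - t)) _); first by nra.
by apply/andP; split; nra.
Qed.

(** * Multiples of [k] modulo [N] *)

Lemma sum_nat_periodic {V : nmodType} (G : nat -> V) (d n : nat) :
  (forall i, G (i + n)%N = G i) ->
  \sum_(i < d * n) G i = (\sum_(i < n) G i) *+ d.
Proof.
move=> Gn; elim: d => [|d IH]; first by rewrite big_ord0.
rewrite mulSn addnC big_split_ord /= IH mulrSr; congr (_ + _).
apply: eq_bigr => i _; rewrite addnC.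
by elim: (d) => [|e IHe]; rewrite ?addn0// mulSn addnCA addnC Gn.
Qed.

(** Multiplication by a unit permutes the residues. *)
Lemma sum_coprime_modn {V : nmodType} (g : nat -> V) (k n : nat) :
  coprime k n -> \sum_(i < n) g (k * i %% n)%N = \sum_(i < n) g i.
Proof.
case: n => [|n] kn; first by rewrite !big_ord0.
have inj : injective (fun i : 'I_n.+1 => inord (k * i %% n.+1) : 'I_n.+1).
  move=> i j /(congr1 val) /=; rewrite !inordK ?ltn_mod// => /eqP e.
  wlog ij : i j e / (i <= j)%N => [H|].
    by case/orP: (leq_total i j) => ij; [|apply/esym]; apply: H => //; rewrite eq_sym.
  move: e; rewrite eq_sym eqn_mod_dvd ?leq_mul// -mulnBr Gauss_dvdr; last by rewrite coprime_sym.
  move=> /dvdn_leq; rewrite subn_gt0 => dl; apply/val_inj/eqP; rewrite eqn_leq ij /=.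
  rewrite leqNgt; apply/negP => /dl; rewrite leqNgt => /negP; apply.
  exact: leq_ltn_trans (leq_subr _ _) (ltn_ord j).
rewrite [RHS](reindex_inj inj) /=; apply: eq_bigr => i _.
by rewrite inordK// ltn_mod.
Qed.

(** As [h] runs over the residues modulo [N], [k h] meets each multiple of [gcd(k, N)] exactly
    [gcd(k, N)] times. *)
Lemma sum_mulmodn_gcdn {V : nmodType} (g : nat -> V) (k N : nat) : (0 < N)%N ->
  \sum_(h < N) g (k * h %% N)%N =
  (\sum_(r < N %/ gcdn k N) g (gcdn k N * r)%N) *+ gcdn k N.
Proof.
move=> N0; set d := gcdn k N; have d0 : (0 < d)%N by rewrite gcdn_gt0 N0 orbT.
have [k' kE] : {k' | k = (k' * d)%N} by exists (k %/ d)%N; rewrite divnK// dvdn_gcdl.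
have [n NE] : {n | N = (n * d)%N} by exists (N %/ d)%N; rewrite divnK// dvdn_gcdr.
have kn : coprime k' n.
  rewrite /coprime -(eqn_pmul2r d0) mul1n muln_gcdl -kE -NE.
  by apply/eqP.
have -> : (N %/ d = n)%N by rewrite NE mulnK.
rewrite -(sum_coprime_modn (fun r => g (d * r)%N) _ _ kn).
rewrite -(@sum_nat_periodic _ (fun r => g (d * (k' * r %% n))%N)); last first.
  by move=> i; rewrite mulnDr addnC modnMDl.
rewrite (_ : (d * n)%N = N); last by rewrite NE mulnC.
apply: eq_bigr => i _; congr (g _).
by rewrite {1}kE muln_modr mulnA (mulnC d n) -NE (mulnC d k').
Qed.

(** * Harmonic sums weighted by gcds *)

Lemma harmonic_sum_le {R : realType} (n : nat) : (0 < n)%N ->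
  \sum_(i < n) (i.+1%:R^-1 : R) <= 1 + ln n%:R.
Proof.
elim: n => // -[_ _|n IH _]; first by rewrite big_ord_recl big_ord0 invr1 ln1.
rewrite big_ord_recr /=; apply: le_trans (lerD (IH isT) (lexx _)) _.
(* What remains is [ln (1 + x) <= x] at [x = - 1 / (n + 2)]. *)
rewrite -addrA lerD2l -lerBrDl -opprB lerNr.
rewrite -ln_div ?posrE ?ltr0n//.
have -> : (n.+1%:R / n.+2%:R : R) = 1 + - n.+2%:R^-1.
  by rewrite -[X in X / _](addrK 1) natr1 mulrBl divff// mul1r.
apply: le_ln1Dx; rewrite ltrN2 invf_lt1 ?ltr0n// ltr1n//.
Qed.

Lemma harmonic_sum_mono {R : realType} (m n : nat) : (m <= n)%N ->
  \sum_(i < m) (i.+1%:R^-1 : R) <= \sum_(i < n) i.+1%:R^-1.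
Proof.
move=> mn; pose F i := i.+1%:R^-1 : R.
rewrite -(big_mkord xpredT F) -(big_mkord xpredT F).
by rewrite [X in _ <= X](@big_cat_nat _ _ _ m)//= lerDl; apply: sumr_ge0 => i _; rewrite /F.
Qed.

Lemma sum_dvdn_inv {R : realType} (d K : nat) : (0 < d)%N ->
  \sum_(k < K | (d %| k.+1)%N) (d%:R / k.+1%:R : R) =
  \sum_(j < K %/ d) j.+1%:R^-1.
Proof.
move=> d0; elim: K => [|K IH]; first by rewrite div0n !big_ord0.
rewrite big_mkcond big_ord_recr -big_mkcond /= IH divnS//.
case: ifPn => dK; last by rewrite addr0.
rewrite /= add1n big_ord_recr /=; congr (_ + _).
have := divnS K d0; rewrite dK add1n => <-.
rewrite -[in LHS](divnK dK) natrM invfM mulrCA divff ?mulr1//.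
by rewrite pnatr_eq0 -lt0n.
Qed.

(** The gcd is one of the common divisors, so it is at most their sum. After exchanging sums, each
    divisor of [N] contributes at most one harmonic number. *)
Lemma sum_gcdn_div_le {R : realType} (N K : nat) : (0 < N)%N ->
  \sum_(k < K) ((gcdn k.+1 N)%:R / k.+1%:R : R) <=
  (tau N)%:R * \sum_(k < K) k.+1%:R^-1.
Proof.
move=> N0; rewrite /tau natr_sum big_distrl /=.
apply: le_trans (_ : _ <= \sum_(d <- divisors N) \sum_(k < K | (d %| k.+1)%N) (d%:R / k.+1%:R)) _.
  under [X in _ <= X]eq_bigr do rewrite big_mkcond.
  rewrite exchange_big; apply: ler_sum => k _.
  have gN : gcdn k.+1 N \in divisors N by rewrite -dvdn_divisors// dvdn_gcdr.
  rewrite (big_rem _ gN) /= dvdn_gcdl lerDl; apply: sumr_ge0 => d _.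
  by case: ifP.
rewrite big_seq [X in _ <= X]big_seq; apply: ler_sum => d; rewrite -dvdn_divisors// => dN.
have d0 : (0 < d)%N by apply: dvdn_gt0 dN.
rewrite sum_dvdn_inv// mul1r.
by rewrite harmonic_sum_mono// leq_div.
Qed.

(* A bound for a sum of at most [N] cosines in arithmetic progression whose step
   is [r / N] turns; the nonzero case is [1 / (t (1 - t))] at [t = r / N]. *)
Definition weyl_weight {R : realType} (N r : nat) : R :=
  if r == 0%N then N%:R else N%:R / r%:R + N%:R / (N - r)%:R.

(** * The quadratic exponential sum *)

Lemma sum_cos_le_weyl_weight {R : realType} (phi : R) (N a L : nat) :
  (0 < N)%N -> (L <= N)%N ->
  \sum_(m < L) cos (phi + m%:R * (2 * (pi * a%:R / N%:R))) <= weyl_weight N (a %% N).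
Proof.
move=> N0 LN; have NR : (0 : R) < N%:R by rewrite ltr0n.
set r := (a %% N)%N; have rN : (r < N)%N by rewrite ltn_mod.
have -> : \sum_(m < L) cos (phi + m%:R * (2 * (pi * a%:R / N%:R))) =
          \sum_(m < L) cos (phi + m%:R * (2 * (pi * r%:R / N%:R))).
  apply: eq_bigr => m _; rewrite [in LHS](divn_eq a N) -/r.
  rewrite -[RHS](cosD_nat2pi _ (m * (a %/ N))); congr cos.
  by rewrite natrD !natrM; field; rewrite gt_eqF.
rewrite /weyl_weight; case: eqP => [_|/eqP r0].
  apply: (@le_trans _ _ (\sum_(m < L) 1)); first by apply: ler_sum => m _; exact: cos_le1.
  by rewrite sumr_const card_ord ler_nat.
have rR : (0 : R) < r%:R by rewrite ltr0n lt0n.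
have NrR : (0 : R) < N%:R - r%:R by rewrite subr_gt0 ltr_nat.
have H := sum_cos_arith_le phi (pi * r%:R / N%:R) L.
set X := \sum_(_ < _) _ in H *.
pose t : R := r%:R / N%:R.
have t01 : 0 <= t <= 1.
  by rewrite divr_ge0//= ler_pdivrMr// mul1r ler_nat ltnW.
have tS : t * (1 - t) <= sin (pi * r%:R / N%:R) by rewrite -mulrA; exact: sin_pi_ge.
have u0 : 0 < t * (1 - t).
  have -> : t * (1 - t) = r%:R * (N%:R - r%:R) / N%:R ^+ 2.
    by rewrite /t; field; rewrite gt_eqF.
  by rewrite divr_gt0 ?mulr_gt0// exprn_gt0.
have -> : N%:R / r%:R + N%:R / (N - r)%:R = (t * (1 - t))^-1.
  rewrite natrB 1?ltnW// /t; field; rewrite !gt_eqF//.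
rewrite -[leRHS]mul1r ler_pdivlMr//.
have [X0|X0] := leP X 0; first by apply: le_trans (ler01); rewrite mulr_le0_ge0// ltW.
apply: le_trans H; rewrite mulrC ler_wpM2r//; first exact: ltW.
exact: le_trans tS (ler_norm _).
Qed.

(** For [r > 0] the weight is [n / r + n / (n - r)], and the second fractions are the first ones in
    reverse order. *)
Lemma sum_weyl_weight_multiples {R : realType} (d n : nat) :
  (0 < d)%N -> (0 < n)%N ->
  \sum_(r < n) weyl_weight (n * d) (d * r) <=
  (n * d)%:R + 2 * n%:R * \sum_(i < n) (i.+1%:R^-1 : R).
Proof.
move=> d0; case: n => // n _; rewrite big_ord_recl muln0 lerD2l.
have dR : d%:R != 0 :> R by rewrite pnatr_eq0 -lt0n.
apply: le_trans (_ : _ <= 2 * n.+1%:R * \sum_(i < n) (i.+1%:R^-1 : R)) _; last first.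
  by rewrite ler_wpM2l// harmonic_sum_mono.
rewrite [leRHS](_ : _ = \sum_(i < n) (n.+1%:R / i.+1%:R) + \sum_(i < n) (n.+1%:R / i.+1%:R)); last first.
  by rewrite -big_distrr /=; ring.
rewrite [X in _ <= _ + X](reindex_inj rev_ord_inj) -big_split /=.
apply: ler_sum => i _; rewrite /weyl_weight muln_eq0 -[d == 0%N]negbK -lt0n d0 /=.
rewrite (mulnC d) -mulnBl !natrM -!mulf_div divff// !mulr1 /bump /= add1n subSS.
by rewrite subnSK.
Qed.

Lemma quadratic_expsum_le {R : realType} (N k : nat) (alpha : R) : (0 < N)%N ->
  sqnorm_expsum N (fun n => pi * k%:R * (n.+1%:R - alpha) ^+ 2 / N%:R) <=
  N%:R + 2 * ((gcdn k N)%:R * N%:R + 2 * N%:R * \sum_(i < N) i.+1%:R^-1).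
Proof.
move=> N0; have NR : (0 : R) < N%:R by rewrite ltr0n.
rewrite sqnorm_expsum_by_difference lerD2l ler_pM2l//.
(* The nonnegative term [h = 0] is added so that [h] runs over all residues. *)
apply: le_trans (_ : _ <= \sum_(h < N) weyl_weight N (k * h %% N)) _.
  case: N N0 NR => // n _ NR; rewrite [leRHS]big_ord_recl /=.
  rewrite -[leLHS]add0r; apply: lerD; first by rewrite muln0 mod0n /weyl_weight /=.
  apply: ler_sum => h _; rewrite /bump /= add1n.
  (* The phase difference at [m = 0]. It alone contains [alpha], whence the uniformity in
     [alpha]. *)
  pose phi : R := pi * k%:R * h.+1%:R * (2 * (1 - alpha) + h.+1%:R) / n.+1%:R.
  apply: le_trans (sum_cos_le_weyl_weight phi _ _ _ (ltn0Sn n) (leq_subr h.+1 n.+1)).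
  apply: ler_sum => m _; rewrite le_eqVlt; apply/orP; left; apply/eqP; congr cos.
  rewrite /phi natrM -addSn natrD -[m.+1%:R]natr1; field.
  by rewrite gt_eqF.
rewrite sum_mulmodn_gcdn//; set d := gcdn k N.
have d0 : (0 < d)%N by rewrite gcdn_gt0 N0 orbT.
have [n NE] : {n | N = (n * d)%N} by exists (N %/ d)%N; rewrite divnK// dvdn_gcdr.
have n0 : (0 < n)%N by case: (n) NE N0 => // ->.
have -> : (N %/ d = n)%N by rewrite NE mulnK.
have H : \sum_(r < n) weyl_weight N (d * r) <=
    N%:R + 2 * n%:R * \sum_(i < N) (i.+1%:R^-1 : R).
  rewrite {1}NE; apply: le_trans (sum_weyl_weight_multiples d n d0 n0) _.
  rewrite -NE lerD2l ler_wpM2l// harmonic_sum_mono// NE.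
  by rewrite leq_pmulr.
have := ler_wpM2l (ler0n R d) H; rewrite mulr_natl => /le_trans; apply.
rewrite mulrDr lerD2l !mulrA (_ : d%:R * 2 * n%:R = 2 * N%:R :> R)//.
by rewrite NE natrM; ring.
Qed.

(** * The Fejer kernel on a finite grid *)

Definition fejer {R : realType} (K : nat) (t : R) : R :=
  K%:R^-1 * sqnorm_expsum K (fun i => i%:R * (2 * (pi * t))).

Lemma fejer_ge0 {R : realType} K (t : R) : 0 <= fejer K t.
Proof. by rewrite mulr_ge0 ?invr_ge0 ?sqnorm_expsum_ge0. Qed.

Lemma fejerE {R : realType} (K : nat) (t : R) : (0 < K)%N ->
  fejer K t = 1 + 2 / K%:R *
    \sum_(h < K.-1) (K - h.+1)%:R * cos (h.+1%:R * (2 * (pi * t))).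
Proof.
move=> K0; have KR : K%:R != 0 :> R by rewrite pnatr_eq0 -lt0n.
rewrite /fejer sqnorm_expsum_by_difference mulrDr mulVf// mulrCA -[in RHS]mulrA.
congr (_ + _ * (_ * _)); apply: eq_bigr => h _.
rewrite (eq_bigr (fun=> cos (h.+1%:R * (2 * (pi * t))))).
  by rewrite sumr_const card_ord [RHS]mulr_natl.
by move=> m _; rewrite natrD; congr cos; ring.
Qed.

Lemma fejerN {R : realType} K (t : R) : (0 < K)%N -> fejer K (- t) = fejer K t.
Proof.
move=> K0; rewrite !fejerE//; congr (_ + _ * _); apply: eq_bigr => h _.
by rewrite !mulrN cosN.
Qed.

Lemma fejer_le {R : realType} K (delta t : R) : (0 < K)%N ->
  0 < delta -> delta <= t <= 1 - delta ->
  fejer K t <= 4 / (K%:R * delta ^+ 2).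
Proof.
move=> K0 d0 /andP[dt t1]; have KR : (0 : R) < K%:R by rewrite ltr0n.
rewrite /fejer invfM [leRHS]mulrCA ler_wpM2l ?invr_ge0//.
have := sqnorm_expsum_arith 0 (pi * t) K.
rewrite (_ : (fun _ => _) = fun i => i%:R * (2 * (pi * t))); last first.
  by apply/funext => i; rewrite add0r.
set X := sqnorm_expsum _ _ => H.
rewrite ler_pdivlMr ?exprn_gt0//.
have X0 : 0 <= X by exact: sqnorm_expsum_ge0.
(* The range of [t] forces [delta <= 1/2], so [t (1 - t) >= delta (1 - delta) >= delta / 2]. *)
have s1 : delta / 2 <= sin (pi * t).
  apply: le_trans (sin_pi_ge t _); last by apply/andP; split; lra.
  by nra.
have s2 : delta ^+ 2 <= 4 * sin (pi * t) ^+ 2 by nra.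
have : X * delta ^+ 2 <= X * (4 * sin (pi * t) ^+ 2) by rewrite ler_wpM2l.
by nra.
Qed.

(** All frequencies of the kernel are below [K <= M], so every nonconstant one averages to zero over
    [M] equally spaced points. *)
Lemma fejer_grid_mean {R : realType} (K M : nat) (s : R) : (0 < K <= M)%N ->
  \sum_(j < M) fejer K (s - j%:R / M%:R) = M%:R.
Proof.
move=> /andP[K0 KM]; have M0 : M%:R != 0 :> R by rewrite pnatr_eq0 -lt0n (leq_trans K0).
under eq_bigr do rewrite fejerE//.
rewrite big_split /= sumr_const card_ord -big_distrr /= exchange_big /=.
rewrite big1 ?mulr0 ?addr0// => h _; rewrite -big_distrr /=.
rewrite (eq_bigr (fun j : 'I_M => cos (- (h.+1%:R * (2 * (pi * s))) +
    j%:R * (2 * (pi * h.+1%:R / M%:R))))).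
  rewrite sum_cos_full_period ?mulr0//=.
  apply: leq_trans KM; case: (K) h => [[]//|k h] /=.
  exact: ltn_ord.
by move=> j _; rewrite -cosN; congr cos; field.
Qed.

(** The kernel averages to 1 over the full grid. The grid points left out, with [j >= L], are at
    distance at least [delta] from [x] modulo 1, so [fejer_le] bounds the loss. *)
Lemma fejer_grid_majorant {R : realType} (K L : nat) (a b delta x : R) :
  (0 < K)%N -> 0 < delta -> (2 * K)%:R * (b - a + 2 * delta) <= L%:R ->
  a <= x <= b ->
  1 <= (2 * K)%:R^-1 * (\sum_(j < L) fejer K (x - (a - delta) - j%:R / (2 * K)%:R))
       + 4 / (K%:R * delta ^+ 2).
Proof.
move=> K0 d0; set M := (2 * K)%N => ML /andP[ax xb].
have M0 : (0 < M)%N by rewrite /M muln_gt0.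
have MR : (0 : R) < M%:R by rewrite ltr0n.
have KR : (0 : R) < K%:R by rewrite ltr0n.
pose F j : R := fejer K (x - (a - delta) - j%:R / M%:R).
have F0 j : 0 <= F j by exact: fejer_ge0.
have FM : \sum_(0 <= j < M) F j = M%:R.
  by rewrite big_mkord fejer_grid_mean// K0 /M leq_pmull.
set e := 4 / _; have e0 : 0 <= e by rewrite divr_ge0 ?mulr_ge0 ?sqr_ge0// ltW.
rewrite -(ler_pM2l MR) mulr1 mulrDr mulrA divff ?gt_eqF// mul1r.
rewrite -(big_mkord xpredT F) -[leLHS]FM.
have [LM|LM] := leqP M L.
  rewrite [X in _ <= X + _](@big_cat_nat _ _ _ M)//= -addrA lerDl.
  by rewrite addr_ge0 ?sumr_ge0// mulr_ge0// ltW.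
rewrite (@big_cat_nat _ _ _ L) ?(ltnW LM)//= lerD2l.
apply: (@le_trans _ _ (\sum_(L <= j < M) e)); last first.
  rewrite sumr_const_nat -[leLHS]mulr_natl ler_wpM2r// ler_nat leq_subr//.
rewrite big_nat [leRHS]big_nat; apply: ler_sum => j /andP[Lj jM].
rewrite /F -fejerN//; apply: fejer_le => //.
have jR : L%:R <= j%:R :> R by rewrite ler_nat.
have jM1 : j%:R / M%:R <= 1 :> R by rewrite ler_pdivrMr// mul1r ler_nat ltnW.
have : b - a + 2 * delta <= j%:R / M%:R.
  by rewrite ler_pdivlMr// mulrC; exact: le_trans jR.
by move=> ?; apply/andP; split; lra.
Qed.

(** * From exponential sums to counting *)

Lemma sum_cosB_le {R : realType} (n m : nat) (u v : nat -> R) :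
  \sum_(i < n) \sum_(j < m) cos (u i - v j) <=
  Num.sqrt (sqnorm_expsum n u) * Num.sqrt (sqnorm_expsum m v).
Proof.
under eq_bigr do under eq_bigr do rewrite cosB.
under eq_bigr do rewrite big_split -!big_distrr /=.
rewrite big_split -!big_distrl /= -sqrtrM ?sqnorm_expsum_ge0//.
apply: le_trans (ler_norm _) _; rewrite -sqrtr_sqr ler_wsqrtr// /sqnorm_expsum.
set A := \sum_(_ < _) _; set B := \sum_(_ < _) _.
set C := \sum_(_ < _) _; set D := \sum_(_ < _) _.
rewrite -subr_ge0; have -> : (A ^+ 2 + C ^+ 2) * (B ^+ 2 + D ^+ 2) - (A * B + C * D) ^+ 2
  = (A * D - B * C) ^+ 2 by ring.
exact: sqr_ge0.
Qed.

(** The constant term of the kernel gives the main term. At each other frequency the double sum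
    splits into a sum over the points and a geometric sum over the grid, of modulus at most
    [2 M / (h + 1)]. *)
Lemma sum_fejer_grid_le {R : realType} (N K L : nat) (x : nat -> R) (y : R) :
  (0 < K)%N ->
  (2 * K)%:R^-1 * (\sum_(n < N) \sum_(j < L) fejer K (x n - y - j%:R / (2 * K)%:R)) <=
  N%:R * (L%:R / (2 * K)%:R) +
  4 * \sum_(h < K) Num.sqrt (sqnorm_expsum N (fun n => h.+1%:R * (2 * (pi * x n)))) / h.+1%:R.
Proof.
move=> K0; set M := (2 * K)%N.
have M0 : (0 < M)%N by rewrite /M muln_gt0.
have MR : (0 : R) < M%:R by rewrite ltr0n.
have KR : (0 : R) < K%:R by rewrite ltr0n.
pose s h : R := Num.sqrt (sqnorm_expsum N (fun n => h.+1%:R * (2 * (pi * x n)))).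
pose phi h : R := h.+1%:R * (2 * (pi * y)).
pose eta h : R := pi * (h.+1%:R / M%:R).
pose v h (j : nat) : R := phi h + j%:R * (2 * eta h).
have -> : \sum_(n < N) \sum_(j < L) fejer K (x n - y - j%:R / M%:R) =
  N%:R * L%:R + 2 / K%:R * \sum_(h < K.-1) (K - h.+1)%:R *
    (\sum_(n < N) \sum_(j < L) cos (h.+1%:R * (2 * (pi * x n)) - v h j)).
  under eq_bigr => n _.
    under eq_bigr do rewrite fejerE//.
    rewrite big_split /= sumr_const card_ord -big_distrr exchange_big /=.
    under eq_bigr do rewrite -big_distrr /=.
    over.
  rewrite big_split /= sumr_const card_ord -[X in X + _]mulr_natl -big_distrr exchange_big /=.
  congr (_ + _ * _); apply: eq_bigr => h _; rewrite -big_distrr /=.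
  congr (_ * _); apply: eq_bigr => n _; apply: eq_bigr => j _; congr cos.
  by rewrite /v /phi /eta; field; rewrite gt_eqF.
rewrite mulrDr [M%:R^-1 * (N%:R * _)]mulrCA [M%:R^-1 * L%:R]mulrC lerD2l.
have vle h : (h < K)%N -> Num.sqrt (sqnorm_expsum L (v h)) <= 2 * M%:R / h.+1%:R.
  move=> hK; have := sqnorm_expsum_arith (phi h) (eta h) L.
  rewrite -/(v h); set X := sqnorm_expsum _ _ => H.
  pose t : R := h.+1%:R / M%:R.
  have t0 : 0 < t by rewrite divr_gt0.
  (* This is where a grid of [2 K] points matters: [t <= 1/2] gives [t (1 - t) >= t / 2]. *)
  have t2 : t <= 1 / 2.
    rewrite /t /M natrM invfM mulrCA mulrC; apply: ler_pM => //; rewrite ?divr_ge0 ?invr_ge0//.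
    by rewrite ler_pdivrMr// mul1r ler_nat.
  have st : t / 2 <= sin (eta h).
    by apply: le_trans (sin_pi_ge t _); [nra | lra].
  have -> : 2 * M%:R / h.+1%:R = 2 / t by rewrite /t; field; rewrite gt_eqF//=.
  have t20 : 0 <= 2 / t by rewrite divr_ge0// ltW.
  rewrite -[leRHS](ger0_norm t20) -sqrtr_sqr ler_wsqrtr//.
  rewrite expr_div_n ler_pdivlMr ?exprn_gt0//.
  have X0 : 0 <= X by exact: sqnorm_expsum_ge0.
  have : X * t ^+ 2 <= X * (4 * sin (eta h) ^+ 2) by rewrite ler_wpM2l//; nra.
  by nra.
have s0 h : 0 <= s h by exact: sqrtr_ge0.
have B0 h : 0 <= s h * (2 * M%:R / h.+1%:R) by rewrite mulr_ge0 ?divr_ge0 ?mulr_ge0// ltW.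
apply: (@le_trans _ _ (M%:R^-1 * (2 / K%:R *
    \sum_(h < K) K%:R * (s h * (2 * M%:R / h.+1%:R))))).
  rewrite ler_pM2l ?invr_gt0// ler_pM2l ?divr_gt0//.
  case: K K0 @M M0 MR KR @eta @v vle B0 => // K _ M M0 MR KR eta v vle B0.
  rewrite [leRHS]big_ord_recr /=; apply: ler_wpDr; first by rewrite mulr_ge0.
  apply: ler_sum => h _.
  apply: (@le_trans _ _ ((K.+1 - h.+1)%:R * (s h * (2 * M%:R / h.+1%:R)))); last first.
    by rewrite ler_wpM2r// ler_nat leq_subr.
  rewrite ler_wpM2l//; apply: le_trans (sum_cosB_le N L (fun n => h.+1%:R * (2 * (pi * x n))) (v h)) _.
  by rewrite ler_wpM2l ?sqrtr_ge0// vle// ltnS ltnW.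
rewrite -big_distrr /= [leRHS]big_distrr /= le_eqVlt; apply/orP; left; apply/eqP.
rewrite [LHS](_ : _ = 2 / M%:R * \sum_(h < K) s h * (2 * M%:R / h.+1%:R)); last first.
  by field; rewrite !gt_eqF.
rewrite big_distrr /=; apply: eq_bigr => h _; rewrite -/(s h); field.
by rewrite nat1r pnatr_eq0 /= gt_eqF.
Qed.

(** The first three losses come from enlarging the interval, from rounding to whole grid points and
    from the tail of the kernel. *)
Definition discrepancy_bound {R : realType} (N K : nat) (delta : R) (x : nat -> R) : R :=
  N%:R * (2 * delta + K%:R^-1 + 4 / (K%:R * delta ^+ 2)) +
  4 * \sum_(h < K) Num.sqrt (sqnorm_expsum N (fun n => h.+1%:R * (2 * (pi * x n)))) / h.+1%:R.

Lemma count_le_discrepancy_bound {R : realType} (N K : nat) (a b delta : R) (x : nat -> R) :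
  (0 < K)%N -> 0 < delta -> a <= b ->
  \sum_(n < N) \1_(`[a, b]) (x n) <= N%:R * (b - a) + discrepancy_bound N K delta x.
Proof.
move=> K0 d0 ab; have KR : (0 : R) < K%:R by rewrite ltr0n.
have MR : (0 : R) < (2 * K)%:R by rewrite ltr0n muln_gt0.
set e : R := 4 / (K%:R * delta ^+ 2).
have e0 : 0 <= e by rewrite divr_ge0 ?mulr_ge0 ?sqr_ge0// ltW.
set w : R := (2 * K)%:R * (b - a + 2 * delta).
have w0 : 0 <= w by rewrite mulr_ge0 ?ltW//; lra.
(* Enough grid points to cover the enlarged interval. Rounding up costs at most one point, that is
   [1 / (2 K) <= 1 / K]. *)
set L := (Num.truncn w).+1.
have wL : w <= L%:R by rewrite ltW// truncnS_gt.
have Lw : L%:R <= w + 1 by rewrite -natr1 lerD2r truncn_le.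
pose T t : R := (2 * K)%:R^-1 * (\sum_(j < L) fejer K (t - (a - delta) - j%:R / (2 * K)%:R)).
have T0 t : 0 <= T t.
  rewrite mulr_ge0//.
  by apply: sumr_ge0 => j _; exact: fejer_ge0.
apply: (@le_trans _ _ (\sum_(n < N) (T (x n) + e))).
  apply: ler_sum => n _; rewrite indicE.
  have [|_] := boolP (x n \in _); last by rewrite addr_ge0.
  by rewrite inE /= in_itv /=; exact: fejer_grid_majorant.
rewrite big_split /= sumr_const card_ord -[e *+ N]mulr_natl -big_distrr /=.
apply: le_trans (lerD (sum_fejer_grid_le N K L x (a - delta) K0) (lexx _)) _.
rewrite /discrepancy_bound -/e addrAC addrA lerD2r -mulrDr -mulrDr ler_wpM2l//.
rewrite !addrA lerD2r.
apply: (@le_trans _ _ ((w + 1) / (2 * K)%:R)).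
  by rewrite ler_wpM2r// invr_ge0 ltW.
rewrite mulrDl /w mulrAC divff ?gt_eqF// !mul1r lerD2l lef_pV2 ?posrE//.
by rewrite ler_nat leq_pmull.
Qed.

Lemma discrepancy_bound_ge0 {R : realType} N K (delta : R) (x : nat -> R) :
  0 <= delta -> 0 <= discrepancy_bound N K delta x.
Proof.
move=> d0; rewrite addr_ge0 ?mulr_ge0 ?addr_ge0 ?invr_ge0 ?mulr_ge0 ?invr_ge0 ?mulr_ge0 ?sqr_ge0//.
by rewrite sumr_ge0// => h _; rewrite divr_ge0 ?sqrtr_ge0.
Qed.

(** The intervals [[0, a]], [[a, b]], [[b, 1]] cover all points, so upper bounds on the outer two
    bound the middle count from below, at the cost of two error terms. *)
Lemma count_sub_length_le {R : realType} (N K : nat) (a b delta : R) (x : nat -> R) :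
  (0 < K)%N -> 0 < delta -> 0 <= a -> a <= b -> b <= 1 ->
  (forall n, 0 <= x n <= 1) ->
  `| \sum_(n < N) \1_(`[a, b]) (x n) - N%:R * (b - a) | <= 2 * discrepancy_bound N K delta x.
Proof.
move=> K0 d0 a0 ab b1 x01.
have H1 := count_le_discrepancy_bound N K a b delta x K0 d0 ab.
have H2 := count_le_discrepancy_bound N K 0 a delta x K0 d0 a0.
have H3 := count_le_discrepancy_bound N K b 1 delta x K0 d0 b1.
have E0 := discrepancy_bound_ge0 N K delta x (ltW d0).
have : N%:R <= \sum_(n < N) \1_(`[0, a]) (x n) + \sum_(n < N) \1_(`[a, b]) (x n)
  + \sum_(n < N) \1_(`[b, 1]) (x n) :> R.
  rewrite -[X in X%:R](card_ord N) -sumr_const -!big_split /=; apply: ler_sum => n _.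
  have /andP[x0 x1] := x01 n; rewrite !indicE !mem_setE !in_itv /= x0 x1 andbT.
  have [xa|/ltW ax] := leP (x n) a; first by rewrite -addrA lerDl addr_ge0.
  rewrite ax add0r; have [xb|/ltW xb] := leP b (x n); first by rewrite lerDr.
  by rewrite xb addr0.
move=> H; rewrite ler_norml; apply/andP; split; lra.
Qed.

(** * The points [(n - alpha)^2 / (2 N)] *)

Lemma sqrt_quadratic_expsum_le {R : realType} (N k : nat) (alpha : R) :
  (0 < N)%N -> 1 <= ln (N%:R : R) ->
  Num.sqrt (sqnorm_expsum N (fun n => pi * k%:R * (n.+1%:R - alpha) ^+ 2 / N%:R)) <=
  3 * Num.sqrt N%:R * ((gcdn k N)%:R + Num.sqrt (ln N%:R)).
Proof.
move=> N0 L1; set L := ln _ in L1 *; set d : R := (gcdn k N)%:R.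
have d1 : 1 <= d by rewrite ler1n gcdn_gt0 N0 orbT.
have sL : Num.sqrt L ^+ 2 = L by rewrite sqr_sqrtr; lra.
have sL0 := sqrtr_ge0 L.
have sN : Num.sqrt N%:R ^+ 2 = N%:R :> R by rewrite sqr_sqrtr.
set B := 3 * _ * _; have B0 : 0 <= B by rewrite !mulr_ge0 ?addr_ge0 ?sqrtr_ge0.
rewrite -(ger0_norm B0) -sqrtr_sqr ler_wsqrtr//.
apply: le_trans (quadratic_expsum_le N k alpha N0) _.
have H : \sum_(i < N) (i.+1%:R^-1 : R) <= 1 + L := harmonic_sum_le N N0.
set S := \sum_(i < N) _ in H *.
rewrite -/d (_ : _ + _ = N%:R * (1 + 2 * d + 4 * S)); last by ring.
rewrite /B !exprMn sN (_ : 3 ^+ 2 * N%:R * _ = N%:R * (9 * (d + Num.sqrt L) ^+ 2)); last by ring.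
(* As [d] and [L] are at least 1, [1 + 2 d + 4 S <= 5 + 2 d + 4 L <= 9 (d^2 + L)]. *)
rewrite ler_wpM2l//; nra.
Qed.

Lemma cos_fractional_part {R : realType} (k : nat) (y : R) :
  cos (k%:R * (2 * (pi * fractional_part y))) = cos (k%:R * (2 * (pi * y))).
Proof.
rewrite -[RHS](cosB_int2pi _ (k%:Z * Num.floor y)) /fractional_part.
by congr cos; rewrite intrM -pmulrn; ring.
Qed.

Lemma sin_fractional_part {R : realType} (k : nat) (y : R) :
  sin (k%:R * (2 * (pi * fractional_part y))) = sin (k%:R * (2 * (pi * y))).
Proof.
rewrite -!cosBpihalf -[RHS](cosB_int2pi _ (k%:Z * Num.floor y)) /fractional_part.
by congr cos; rewrite intrM -pmulrn; ring.
Qed.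

Lemma fractional_part_itv {R : realType} (y : R) : 0 <= fractional_part y <= 1.
Proof.
have /andP[h1 h2] := floor_itv y; move: h2; rewrite intrD => h2.
by rewrite /fractional_part; apply/andP; split; lra.
Qed.

Lemma local_discrepancy_le {R : realType} (N : nat) (alpha a b : R) :
  (0 < N)%N -> 1 <= ln (N%:R : R) -> 0 <= a -> a <= b -> b <= 1 ->
  local_discrepancy N alpha a b <=
  110 * (ln N%:R * (Num.sqrt (ln N%:R) + (tau N)%:R) / Num.sqrt N%:R).
Proof.
move=> N0 L1 a0 ab b1; have NR : (0 : R) < N%:R by rewrite ltr0n.
pose y n : R := (n.+1%:R - alpha) ^+ 2 / (2 * N%:R).
pose x n : R := fractional_part (y n).
have x01 n : 0 <= x n <= 1 by exact: fractional_part_itv.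
(* With [delta = 1 / N] the losses total [2 + 1 / N^2 + 4 <= 7]. *)
pose K := (N ^ 3)%N.
have K0 : (0 < K)%N by rewrite expn_gt0 N0.
have delta0 : (0 : R) < N%:R^-1 by rewrite invr_gt0.
have := count_sub_length_le N K a b N%:R^-1 x K0 delta0 a0 ab b1 x01.
set E := discrepancy_bound _ _ _ _ => HE.
set L : R := ln N%:R in L1 *; set t : R := (tau N)%:R.
have t1 : 1 <= t.
  rewrite ler1n /tau sum1_size lt0n size_eq0.
  by apply/eqP => d0; have := dvd1n N; rewrite dvdn_divisors// d0.
set q := Num.sqrt (N%:R : R).
have q0 : 0 < q by rewrite sqrtr_gt0.
have qq : q ^+ 2 = N%:R by rewrite sqr_sqrtr.
have q1 : 1 <= q by rewrite -sqrtr1 ler_wsqrtr// ler1n.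
set l := Num.sqrt L; have l0 : 0 <= l by exact: sqrtr_ge0.
have EE : E <= 7 + 48 * q * (L * (l + t)).
  rewrite /E /discrepancy_bound; apply: lerD.
    rewrite (_ : N%:R * _ = 6 + (N%:R ^+ 2)^-1); last first.
      by rewrite /K natrX; field; rewrite gt_eqF.
    suff : (N%:R ^+ 2)^-1 <= 1 :> R by lra.
    by rewrite invf_le1 ?exprn_gt0// -natrX ler1n expn_gt0 N0.
  (* Here [1 + ln K = 1 + 3 L <= 4 L]. The factor 48 above is [4 * 3 * 4]. *)
  have HK : \sum_(h < K) (h.+1%:R^-1 : R) <= 4 * L.
    apply: le_trans (harmonic_sum_le K K0) _.
    rewrite natrX lnXn// mulr_natl -/L; lra.
  have Hg : \sum_(h < K) ((gcdn h.+1 N)%:R / h.+1%:R : R) <= t * (4 * L).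
    by apply: le_trans (sum_gcdn_div_le N K N0) _; rewrite ler_wpM2l.
  apply: (@le_trans _ _ (4 * \sum_(h < K) 3 * q *
      ((gcdn h.+1 N)%:R / h.+1%:R + l * h.+1%:R^-1))).
    rewrite ler_pM2l//; apply: ler_sum => h _.
    rewrite -mulrDl mulrA ler_wpM2r//.
    apply: le_trans (sqrt_quadratic_expsum_le N h.+1 alpha N0 L1).
    rewrite ler_wsqrtr// /sqnorm_expsum le_eqVlt; apply/orP; left; apply/eqP.
    have ph n : h.+1%:R * (2 * (pi * y n)) = pi * h.+1%:R * (n.+1%:R - alpha) ^+ 2 / N%:R.
      by rewrite /y; field; rewrite gt_eqF.
    by congr (_ ^+ 2 + _ ^+ 2); apply: eq_bigr => n _;
       rewrite ?cos_fractional_part ?sin_fractional_part ph.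
  rewrite -big_distrr big_split -big_distrr /=.
  set A := \sum_(_ < _) _ in Hg *; set B := \sum_(_ < _) _ in HK *.
  have : A + l * B <= t * (4 * L) + l * (4 * L) by rewrite lerD// ler_wpM2l.
  by nra.
have -> : local_discrepancy N alpha a b =
    N%:R^-1 * `| \sum_(n < N) \1_(`[a, b]) (x n) - N%:R * (b - a) |.
  rewrite -[X in X * _](gtr0_norm delta0) -normrM /local_discrepancy mulrBr mulKf ?gt_eqF//.
  by rewrite big_add1 /= big_mkord.
apply: (@le_trans _ _ (N%:R^-1 * (2 * (7 + 48 * q * (L * (l + t)))))).
  by rewrite ler_pM2l//; apply: le_trans HE _; rewrite ler_wpM2l.
(* Since [P >= 1] and [q >= 1], the constant 14 is absorbed: [14 + 96 = 110]. *)
have Lt : 1 <= L * (l + t) by nra.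
set P := L * (l + t) in Lt *.
rewrite -qq [leLHS](_ : _ = (14 / q + 96 * P) / q); last by field; rewrite gt_eqF.
rewrite mulrA ler_pM2r ?invr_gt0//.
have : 14 / q <= 14 by rewrite ler_pdivrMr//; nra.
by lra.
Qed.

Theorem propositionA1 (R : realType) :
  exists C : R, \forall N \near \oo, forall alpha : R,
    discrepancy N alpha <=
      C * (ln (N%:R : R) * (Num.sqrt (ln (N%:R : R)) + (tau N)%:R)
           / Num.sqrt (N%:R : R)).
Proof.
(* The threshold ensures [N >= e], hence [ln N >= 1]. *)
exists 110; exists (Num.truncn (expR 1 : R)).+1 => // N /= leN alpha.
have eN : expR 1 <= N%:R :> R.
  by apply: le_trans (ltW (truncnS_gt _)) _; rewrite ler_nat.
have N0 : (0 < N)%N by exact: leq_trans leN.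
have L1 : 1 <= ln (N%:R : R) by rewrite -[leLHS]expRK ler_ln ?posrE ?expR_gt0 ?ltr0n.
apply: ge_sup.
  by exists (local_discrepancy N alpha 0 1); exists 0, 1.
move=> _ [a [b [a0 ab b1 ->]]].
exact: local_discrepancy_le (ltW ab) b1.
Qed.
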